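(* For every $q\in(-1,0)$ the function $\theta(q,\cdot)$ has infinitely many negative and infinitely many positive real zeros.
   Context: For $q\in\mathbb{C}$, $|q|<1$, the partial theta function is $\theta(q,x):=\sum_{j=0}^{\infty}q^{j(j+1)/2}x^j$, which is an entire function of $x$. *)

(* Defs.v *)
From mathcomp Require Import all_boot all_order all_algebra.
From mathcomp Require Import all_classical all_reals all_analysis.
Set Implicit Arguments.
Unset Strict Implicit.
Unset Printing Implicit Defensive.
Import Order.TTheory GRing.Theory Num.Theory.
Import numFieldNormedType.Exports.
Local Open Scope classical_set_scope.
Local Open Scope ring_scope.

(* MathComp-Analysis. The limit is taken in [K] for the topology of its norm:
   the usual one on C when [K] is [R[i]] with [R : realType]. [limn] is total;
   over C the series converges for all [x] when [`|q| < 1], the only case of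
   interest. The division in the exponent is exact. *)
Definition theta (K : numFieldType) (q x : K) : K :=
  limn (series (fun j : nat => q ^+ (j * j.+1 %/ 2)%N * x ^+ j)).

(* Main.v *)
Require Import Defs.
From mathcomp Require Import all_boot all_order all_algebra complex.
From mathcomp Require Import all_classical all_reals all_analysis.
From mathcomp Require Import ring lra zify.
Import Order.TTheory GRing.Theory Num.Theory.
Import numFieldNormedType.Exports.
Local Open Scope classical_set_scope.
Local Open Scope ring_scope.
Local Open Scope complex_scope.
Set Implicit Arguments.
Unset Strict Implicit.
Unset Printing Implicit Defensive.

(** Let [|q| < 1]. The series gives [theta q x = 1 + q x theta q (q x)]; read at
    [x / q] this is [theta q (x / q) = 1 + x theta q x]. Hence, once a point [x]
    with [2 <= |x|] and [1 < |theta q x|] is known, the term [x theta q x]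
    dominates the [1] along the whole orbit [x / q ^+ n]: the values stay larger
    than 1 in absolute value and the sign of [theta q (x / q)] is that of
    [x * theta q x]. For [q < 0] two such steps keep the sign of the point and
    flip the sign of the value ([theta_orbit_sign]). So the intermediate value
    theorem yields a zero between [x / q ^+ n] and [x / q ^+ n.+2] for every [n];
    even [n] give zeros of the sign of [x], odd [n] zeros of the opposite sign,
    and both families are unbounded ([theta_zero_beyond]).

    What remains is a starting point, and it suffices that [theta q] is unbounded
    on every half-line [B <= x] ([theta_unbounded]). This is the only delicate
    point, since cancellations along the real axis do occur: near [|q| = 1] no
    single term of the series controls the sum. The argument is a [c]-difference
    analogue of a Cauchy estimate, with [c = sqrt |q|]. The operator
    [f |-> c ^+ s * f (x / c) - f x] kills the monomial [x ^+ s], multiplies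
    [x ^+ j] by [c ^+ s / c ^+ j - 1], and at most doubles a bound of [f] on a
    half-line. Applying it for all [s <= 2 N] other than [N] removes from the
    theta series every term of index at most [2 N] but the middle one. At
    [x = c ^- N] the terms with [j > 2 N] are at most [c ^+ j] in absolute value,
    whereas the middle one is at least [\prod_(k < N) ((1 - c) ^+ 2 / c ^+ k)], which outgrows the
    bound [4 ^+ N * M + (1 - c)^-1] that [|theta q| <= M] would force. *)

(** * Triangular exponents *)

Lemma triangularS j : (j.+1 * j.+2 %/ 2 = j * j.+1 %/ 2 + j.+1)%N.
Proof. by rewrite -divnDMl //; congr (_ %/ _)%N; lia. Qed.

Lemma mul2_triangular j : (2 * (j * j.+1 %/ 2) = j * j.+1)%N.
Proof. elim: j => // j IH; rewrite triangularS mulnDr IH; lia. Qed.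

(** * Convergence, continuity and the functional equation *)

(** Equivalently, the power series with coefficients [a] has infinite radius of
    convergence. Stated as bounds, the property passes to formal derivatives
    without any manipulation of series. *)
Definition rapidly_decreasing (R : realType) (a : R^nat) :=
  forall r : R, 0 < r -> exists C : R, forall j, `|a j| * r ^+ j <= C.

Lemma rapid_cvg_pseries (R : realType) (a : R^nat) (x : R) :
  rapidly_decreasing a -> cvgn (pseries a x).
Proof.
move=> ra; have r0 : 0 < 2 * (`|x| + 1) by have := normr_ge0 x; lra.
have [C aC] := ra _ r0.
have C0 : 0 <= C by apply: le_trans (aC 0%N); rewrite expr0 mulr1.
apply: normed_cvg; apply: (@series_le_cvg _ _ (geometric C 2^-1)).
- by move=> n /=; exact: normr_ge0.
- by move=> n /=; rewrite mulr_ge0 // exprn_ge0 // invr_ge0.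
- move=> n /=; rewrite normrM normrX exprVn.
  rewrite ler_pdivlMr ?exprn_gt0 //; apply: le_trans (aC n).
  rewrite -mulrA ler_wpM2l // -exprMn lerXn2r ?nnegrE ?mulr_ge0 //;
    have := normr_ge0 x; lra.
- by apply: is_cvg_geometric_series; rewrite ger0_norm ?invr_ge0 // invf_lt1 ?ltr1n.
Qed.

(** The factor [j.+1] produced by a derivation is absorbed in [2 ^+ j.+1]. *)
Lemma rapid_pseries_diffs (R : realType) (a : R^nat) :
  rapidly_decreasing a -> rapidly_decreasing (pseries_diffs a).
Proof.
move=> ra r r0; have [C aC] := ra (2 * r) ltac:(lra).
exists (C / r) => j; rewrite /pseries_diffs ler_pdivlMr // -mulrA -exprSr
  normrM normr_nat.
apply: le_trans (aC j.+1); rewrite exprMn mulrA [`|a _| * 2 ^+ _]mulrC.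
rewrite !ler_wpM2r ?exprn_ge0 ?(ltW r0) //.
by rewrite -natrX ler_nat ltnW // ltn_expl.
Qed.

Lemma rapid_continuous (R : realType) (a : R^nat) :
  rapidly_decreasing a -> continuous (fun x : R => limn (pseries a x)).
Proof.
move=> ra x; have ra' := rapid_pseries_diffs ra; have ra'' := rapid_pseries_diffs ra'.
have [|dx _] := @pseries_snd_diffs R a (`|x| + 1) x (rapid_cvg_pseries ra)
  (rapid_cvg_pseries ra') (rapid_cvg_pseries ra'').
  by rewrite [ltRHS]ger0_norm ?addr_ge0 // ltrDl.
by apply: differentiable_continuous; exact/derivable1_diffP.
Qed.

Lemma rapid_theta (R : realType) (q : R) : `|q| < 1 ->
  rapidly_decreasing (fun j : nat => q ^+ (j * j.+1 %/ 2)).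
Proof.
move=> q1 r r0.
(* The ratio of consecutive terms is [|q| ^+ j.+1 * r], at most 1 from [N] on. *)
have [N qN] : exists N : nat, forall n, (N <= n)%N -> `|q| ^+ n * r <= 1.
  have /cvgrPdist_lt /(_ r^-1) : `|q| ^+ n @[n --> \oo] --> 0.
    by apply: cvg_expr; rewrite normr_id.
  rewrite invr_gt0 => /(_ r0) [N _ NP]; exists N => n /NP /=.
  rewrite sub0r normrN normrX normr_id => /ltW qn.
  by rewrite -ler_pdivlMr // mul1r.
pose u (j : nat) := `|q ^+ (j * j.+1 %/ 2)| * r ^+ j.
have u0 j : 0 <= u j by rewrite mulr_ge0 // exprn_ge0 // ltW.
have uS j : u j.+1 = u j * (`|q| ^+ j.+1 * r).
  by rewrite /u triangularS exprD normrM !normrX [r ^+ _]exprSr mulrACA.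
exists (\sum_(i < N.+1) u i) => j; rewrite -/(u j).
have small : forall k, (k <= N)%N -> u k <= \sum_(i < N.+1) u i.
  move=> k kN; rewrite (bigD1 (Ordinal (kN : (k < N.+1)%N))) //= lerDl.
  exact: sumr_ge0.
have [jN|/ltnW Nj] := leqP j N; first exact: small.
rewrite -(subnK Nj); elim: (j - N)%N => [|k IH]; first exact: small.
rewrite addSn uS; apply: le_trans IH; rewrite ler_piMr // qN //; lia.
Qed.

Lemma theta_cvg (R : realType) (q x : R) : `|q| < 1 ->
  series (fun j : nat => q ^+ (j * j.+1 %/ 2) * x ^+ j) @ \oo --> theta q x.
Proof. by move=> q1; apply: (rapid_cvg_pseries (rapid_theta _)). Qed.

Lemma theta_continuous (R : realType) (q : R) : `|q| < 1 ->
  continuous (theta q : R -> R).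
Proof. by move=> q1; apply: (rapid_continuous (rapid_theta _)). Qed.

Lemma theta_functional (R : realType) (q x : R) : `|q| < 1 ->
  theta q x = 1 + q * x * theta q (q * x).
Proof.
move=> q1; apply: cvg_lim; first exact: norm_hausdorff.
rewrite -cvg_shiftS /=.
have -> : (fun n => series (fun j : nat => q ^+ (j * j.+1 %/ 2) * x ^+ j) n.+1) =
  (fun n => 1 + q * x * series (fun j : nat => q ^+ (j * j.+1 %/ 2) * (q * x) ^+ j) n).
  apply/funext => n; rewrite /series /= big_nat_recl //= mulr1; congr (1 + _).
  rewrite mulr_sumr; apply: eq_bigr => i _.
  rewrite triangularS exprD exprMn !exprSr; ring.
by apply: cvgD; [exact: cvg_cst | apply: cvgMr; exact: theta_cvg].
Qed.

(** The series with real data has the same partial sums over [R] and over [R[i]],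
    and the norm of [R[i]] restricts to the absolute value, so the real theory
    decides the zeros of the complex function on the real line. *)
Lemma theta_real_complex (R : realType) (q x : R) : `|q| < 1 ->
  theta (q%:C : R[i]) (x%:C : R[i]) = (theta q x)%:C.
Proof.
move=> q1; apply: cvg_lim; first exact: norm_hausdorff.
have -> : series (fun j : nat => (q%:C : R[i]) ^+ (j * j.+1 %/ 2) * x%:C ^+ j) =
  (fun n => (series (fun j : nat => q ^+ (j * j.+1 %/ 2) * x ^+ j) n)%:C).
  apply/funext => n; rewrite /series /= rmorph_sum /=.
  by apply: eq_bigr => j _; rewrite rmorphM !rmorphXn.
apply/cvgrPdist_lt => -[e e'] /=; rewrite ltcE /= => /andP[/eqP -> e0].
have /cvgrPdist_lt /(_ e e0) := theta_cvg (x := x) q1.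
apply: filterS => n; rewrite -rmorphB /= normc_def /= expr0n addr0 sqrtr_sqr.
by rewrite ltcE /= eqxx.
Qed.

(** * Difference operators that isolate one coefficient *)

Definition qdiff (R : realType) (c : R) (s : nat) (f : R -> R) : R -> R :=
  fun x => c ^+ s * f (x / c) - f x.

(** The integers of [[0, 2 N]] other than [N], listed as pairs symmetric about
    [N]: the two factors of a pair combine into the estimates below. *)
Definition pairs_around (N : nat) : seq nat :=
  [seq (N - k.+1)%N | k <- index_iota 0 N] ++ [seq (N + k.+1)%N | k <- index_iota 0 N].

Lemma big_pairs_around (R : comNzRingType) (N : nat) (F : nat -> R) :
  \prod_(s <- pairs_around N) F s =
  \prod_(k < N) (F (N - k.+1)%N * F (N + k.+1)%N).
Proof.
rewrite /pairs_around big_cat !big_map big_split /=; by rewrite !big_mkord.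
Qed.

Lemma mem_pairs_around (N j : nat) :
  (j \in pairs_around N) = (j != N) && (j <= N.*2)%N.
Proof.
rewrite mem_cat; apply/idP/andP => [/orP[] /mapP[k]|[jN j2N]].
- by rewrite mem_index_iota => kN ->; split; lia.
- by rewrite mem_index_iota => kN ->; split; lia.
have [jltN|Nltj] := ltnP j N; apply/orP; [left|right]; apply/mapP.
  by exists (N - j.+1)%N; rewrite ?mem_index_iota; lia.
by exists (j - N.+1)%N; rewrite ?mem_index_iota; lia.
Qed.

Section QDifferences.
Variables (R : realType) (c : R).
Hypotheses (c_gt0 : 0 < c) (c_lt1 : c < 1).

Lemma qdiffs_series (S : seq nat) (u : R^nat) (f : R -> R) :
    (forall x, series (fun j => u j * x ^+ j) @ \oo --> f x) ->
  forall x, series (fun j => \prod_(s <- S) (c ^+ s / c ^+ j - 1) * u j * x ^+ j)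
    @ \oo --> foldr (qdiff c) f S x.
Proof.
move=> uf; elim: S => [|s S IH] x /=.
  by under eq_fun do rewrite big_nil mul1r; exact: uf.
have -> : series (fun j => \prod_(s <- s :: S) (c ^+ s / c ^+ j - 1) * u j * x ^+ j) =
  (fun n => c ^+ s *
      series (fun j => \prod_(s <- S) (c ^+ s / c ^+ j - 1) * u j * (x / c) ^+ j) n
    - series (fun j => \prod_(s <- S) (c ^+ s / c ^+ j - 1) * u j * x ^+ j) n).
  apply/funext => n; rewrite /series /= mulr_sumr -sumrB.
  apply: eq_bigr => j _; rewrite big_cons exprMn exprVn; ring.
by apply: cvgB; [apply: cvgMr; exact: IH | exact: IH].
Qed.

(** As [c < 1], the half-line [B <= x] is stable under [x |-> x / c]; this is why
    a bound near infinity suffices. *)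
Lemma qdiffs_bounded (S : seq nat) (f : R -> R) (B M : R) :
    0 <= B -> (forall x, B <= x -> `|f x| <= M) ->
  forall x, B <= x -> `|foldr (qdiff c) f S x| <= 2 ^+ size S * M.
Proof.
move=> B0 fM; elim: S => [|s S IH] x Bx /=; first by rewrite mul1r fM.
apply: le_trans (ler_normB _ _) _; rewrite exprS -mulrA mulr2n mulrDl !mul1r.
apply: lerD; last exact: IH.
rewrite normrM; apply: le_trans (IH (x / c) _); last first.
  by rewrite ler_pdivlMr // (le_trans _ Bx) // ler_piMr // ltW.
by rewrite ler_piMl // normrX gtr0_norm // exprn_ile1 // ltW.
Qed.

Lemma le_dominant_term (t : R^nat) (l : R) (N : nat) :
    (forall j, j != N -> `|t j| <= c ^+ j) -> series t @ \oo --> l ->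
  `|t N| <= `|l| + (1 - c)^-1.
Proof.
move=> tc tl; have c1 : 0 < 1 - c by rewrite subr_gt0.
rewrite -lerBlDr; have nl : `|series t n| @[n --> \oo] --> `|l| by exact: cvg_norm tl.
rewrite -(cvg_lim _ nl); last exact: norm_hausdorff.
apply: limr_ge; first by apply/cvg_ex; exists `|l|.
exists N.+1 => // n /= Nn.
rewrite /series /= big_mkord (bigD1 (Ordinal Nn)) //=.
set r := \sum_(i < n | _) _.
suff rc : `|r| <= (1 - c)^-1.
  by rewrite lerBlDr -{1}[t N](addrK r) (le_trans (ler_normB _ _)) // lerD2l.
apply: le_trans (ler_norm_sum _ _ _) _.
apply: (@le_trans _ _ (\sum_(i < n) c ^+ i)).
  rewrite [leRHS](bigD1 (Ordinal Nn)) //= -[leLHS]add0r.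
  apply: lerD; first by rewrite exprn_ge0 // ltW.
  by apply: ler_sum => i iN; apply: tc; apply: contra iN => /eqP iN; exact/eqP/val_inj.
rewrite -[leRHS]mul1r ler_pdivlMr // -[1 - c]opprB mulrN mulrC -subrX1.
by rewrite opprB gerDl oppr_le0 exprn_ge0 // ltW.
Qed.

(** With [y = c ^+ k.+1], the pair [N - k.+1], [N + k.+1] contributes
    [|(y^-1 - 1) * (y - 1)| = (1 - y) ^+ 2 / y], and [y <= c]. The factor [c ^+ N]
    is what [|q| ^+ (N * N.+1 %/ 2) * x ^+ N] amounts to at [x = c ^- N]. *)
Lemma qdiffs_diagonal_ge (N : nat) :
  \prod_(k < N) ((1 - c) ^+ 2 / c ^+ k) <=
  c ^+ N * `|\prod_(s <- pairs_around N) (c ^+ s / c ^+ N - 1)|.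
Proof.
rewrite big_pairs_around -[N in c ^+ N * _]card_ord -prodr_const normr_prod -big_split /=.
apply: ler_prod => k _; apply/andP; split.
  by rewrite divr_ge0 ?exprn_ge0 ?subr_ge0 // ltW.
set y := c ^+ k.+1; have y0 : 0 < y by rewrite exprn_gt0.
have yc : y <= c by rewrite /y exprS ler_piMr ?exprn_ile1 // ltW.
have -> : c ^+ (N - k.+1) / c ^+ N = y^-1.
  by rewrite -[X in _ / c ^+ X](subnK (ltn_ord k)) exprD invfM mulrA divff ?mul1r //
    lt0r_neq0 // exprn_gt0.
have -> : c ^+ (N + k.+1) / c ^+ N = y.
  by rewrite exprD mulrAC divff ?mul1r // lt0r_neq0 // exprn_gt0.
have -> : (y^-1 - 1) * (y - 1) = - ((1 - y) ^+ 2 / y).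
  by field; rewrite lt0r_neq0.
rewrite normrN ger0_norm; last by rewrite divr_ge0 ?exprn_ge0 ?subr_ge0 ?(le_trans yc) // ltW.
have -> : c ^+ k = y / c by rewrite /y exprSr mulfK // lt0r_neq0.
have -> : c * ((1 - y) ^+ 2 / y) = (1 - y) ^+ 2 / (y / c).
  by field; rewrite !lt0r_neq0.
rewrite ler_wpM2r ?invr_ge0 ?divr_ge0 ?(ltW y0) ?(ltW c_gt0) //.
by rewrite lerXn2r ?nnegrE ?subr_ge0 ?(le_trans yc) ?lerD2l ?lerN2 // ltW.
Qed.

(** For [j <= 2 N] the factor of node [s = j] is 0. For [j > 2 N] each factor is
    at most [c ^+ s / c ^+ j] in absolute value. The nodes add up to
    [2 N ^ 2], so the left-hand side is at most [c] to the power
    [j (j + 1) - N j + 2 N ^ 2 - 2 N j = j + (j - N) (j - 2 N)]. *)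
Lemma qdiffs_offdiagonal_le (N j : nat) : j != N ->
  c ^+ (j * j.+1) / c ^+ (N * j) * `|\prod_(s <- pairs_around N) (c ^+ s / c ^+ j - 1)|
    <= c ^+ j.
Proof.
move=> jN; have [j2N|Nj] := leqP j N.*2.
  have jS : j \in pairs_around N by rewrite mem_pairs_around jN.
  rewrite (big_rem j jS) /= divff ?subrr ?mul0r ?normr0 ?mulr0 ?exprn_ge0 ?ltW //.
  by rewrite lt0r_neq0 // exprn_gt0.
have factor s : (s <= j)%N -> `|c ^+ s / c ^+ j - 1| <= c ^+ s / c ^+ j.
  move=> sj; rewrite ger0_norm ?gerBl // subr_ge0 ler_pdivlMr ?exprn_gt0 // mul1r.
  by rewrite ler_wiXn2l // ltW.
have bound : `|\prod_(s <- pairs_around N) (c ^+ s / c ^+ j - 1)|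
    <= (c ^+ N.*2 / c ^+ j.*2) ^+ N.
  rewrite big_pairs_around normr_prod -[X in _ <= _ ^+ X]card_ord -prodr_const.
  apply: ler_prod => k _; rewrite normr_ge0 normrM /=.
  have -> : c ^+ N.*2 / c ^+ j.*2 =
      (c ^+ (N - k.+1) / c ^+ j) * (c ^+ (N + k.+1) / c ^+ j).
    rewrite mulrACA -exprD -invfM -exprD !addnn; congr (c ^+ _ / _).
    by have := ltn_ord k; lia.
  by rewrite ler_pM // factor //; have := ltn_ord k; lia.
apply: le_trans (ler_wpM2l _ bound) _.
  by rewrite divr_ge0 // exprn_ge0 // ltW.
rewrite exprMn exprVn -!exprM mulrACA -exprD -invfM -exprD.
rewrite ler_pdivrMr ?exprn_gt0 // -exprD ler_wiXn2l ?ltW //; nia.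
Qed.
End QDifferences.

(** * Unboundedness on half-lines *)

Lemma prod_unbounded (R : realType) (e : R^nat) (m : nat) (K : R) (N0 : nat) :
    (forall k, 0 < e k) -> (forall k, (m <= k)%N -> 2 <= e k) ->
  exists2 N, (N0 <= N)%N & K < \prod_(k < N) e k.
Proof.
move=> e0 e2; pose P := \prod_(k < m) e k; have P0 : 0 < P by apply: prodr_gt0.
have grow n : P * 2 ^+ n <= \prod_(k < m + n) e k.
  elim: n => [|n IH]; first by rewrite addn0 mulr1.
  rewrite addnS big_ord_recr /= exprSr mulrA ler_pM ?e2 ?leq_addr //.
  by rewrite mulr_ge0 ?exprn_ge0 // ltW.
pose b := Num.bound (`|K| / P); exists (m + (N0 + b))%N; first lia.
apply: lt_le_trans (grow _); rewrite mulrC -ltr_pdivrMr //.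
have Kb : K / P < b%:R.
  apply: le_lt_trans (archi_boundP _); last by rewrite divr_ge0 // ltW.
  by rewrite ler_pM2r ?invr_gt0 // ler_norm.
apply: lt_trans Kb _; rewrite -natrX ltr_nat.
by apply: leq_ltn_trans (ltn_expl _ (ltnSn 1)); lia.
Qed.

(** If [|theta q| <= M] from [Num.max B 1] on, the difference operators of the
    nodes around [N], evaluated at [c ^- N], give
    [\prod_(k < N) ((1 - c) ^+ 2 / c ^+ k) <= 4 ^+ N * M + (1 - c)^-1] for all
    large [N]. Dividing by [4 ^+ N] leaves a product of factors tending to
    infinity on the left, and a bounded quantity on the right. *)
Lemma theta_unbounded (R : realType) (q B M : R) : 0 < `|q| < 1 ->
  exists2 x : R, B <= x & M < `|theta q x|.
Proof.
move=> /andP[q0 q1]; apply: contrapT => noX.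
have {noX} thM x : Num.max B 1 <= x -> `|theta q x| <= M.
  rewrite ge_max => /andP[Bx _]; rewrite leNgt; apply/negP => Mx.
  by apply: noX; exists x.
(* With [|q| = c ^+ 2], the coefficient of [x ^+ j] has size [c ^+ (j * j.+1)],
   which still beats the growth [c ^- (2 N j)] caused by the operators. *)
pose c : R := Num.sqrt `|q|.
have c0 : 0 < c by rewrite sqrtr_gt0.
have cE : c ^+ 2 = `|q| by rewrite sqr_sqrtr.
have c1 : c < 1 by rewrite -(expr_lt1 (n := 2)) ?cE // ltW.
have c'0 : 0 < 1 - c by rewrite subr_gt0.
have Vc_large (A : R) : exists m, forall k, (m <= k)%N -> A <= (c ^+ k)^-1.
  have /cvgrPdist_lt /(_ (`|A| + 1)^-1) : c ^+ n @[n --> \oo] --> 0.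
    by apply: cvg_expr; rewrite gtr0_norm.
  rewrite invr_gt0 ltr_wpDl // => /(_ isT) [m _ mP]; exists m => k /mP /=.
  rewrite sub0r normrN gtr0_norm ?exprn_gt0 // => /ltW ck.
  apply: (@le_trans _ _ (`|A| + 1)); first by rewrite (le_trans (ler_norm _)) // lerDl.
  by rewrite -[leLHS]invrK lef_pV2 // posrE ?exprn_gt0 // invr_gt0 ltr_wpDl.
pose e k : R := ((1 - c) / 2) ^+ 2 / c ^+ k.
have [m em] : exists m, forall k, (m <= k)%N -> 2 <= e k.
  have [m mP] := Vc_large (2 / ((1 - c) / 2) ^+ 2); exists m => k /mP.
  by rewrite ler_pdivrMr ?exprn_gt0 ?divr_gt0 // /e mulrC.
have [N0 N0P] := Vc_large (Num.max B 1).
have [] := @prod_unbounded R e m (M + (1 - c)^-1) N0 _ em.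
  by move=> k; rewrite /e divr_gt0 ?exprn_gt0 ?divr_gt0.
move=> N /N0P BN; apply/negP; rewrite -leNgt.
set x := (c ^+ N)^-1 in BN.
pose t (j : nat) := \prod_(s <- pairs_around N) (c ^+ s / c ^+ j - 1)
  * q ^+ (j * j.+1 %/ 2) * x ^+ j.
have tE j : `|t j| = c ^+ (j * j.+1) / c ^+ (N * j) *
    `|\prod_(s <- pairs_around N) (c ^+ s / c ^+ j - 1)|.
  rewrite /t !normrM !normrX -cE -exprM mul2_triangular [`|x|]gtr0_norm ?invr_gt0 ?exprn_gt0 //.
  by rewrite -mulrA mulrC /x exprVn -exprM.
have tN : \prod_(k < N) ((1 - c) ^+ 2 / c ^+ k) <= `|t N|.
  rewrite tE mulnS exprD mulfK ?lt0r_neq0 ?exprn_gt0 //.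
  exact: qdiffs_diagonal_ge.
have tj j : j != N -> `|t j| <= c ^+ j by rewrite tE; exact: qdiffs_offdiagonal_le.
have tl := @qdiffs_series _ c (pairs_around N) _ _ (fun x => theta_cvg (x := x) q1) x.
have := le_dominant_term c0 c1 tj tl.
have := qdiffs_bounded c0 c1 (pairs_around N) _ thM BN.
rewrite (_ : size _ = N.*2); last first.
  by rewrite size_cat !size_map size_iota; lia.
rewrite le_max ler01 orbT => /(_ isT) fM tNl.
have {tN tNl fM} main := le_trans tN (le_trans tNl (lerD fM (lexx _))).
have M0 : 0 <= M by apply: le_trans (thM _ (lexx _)).
have p4 : 1 <= 2 ^+ N.*2 :> R by rewrite exprn_ege1 // ler1n.
have -> : \prod_(k < N) e k = \prod_(k < N) ((1 - c) ^+ 2 / c ^+ k) / 2 ^+ N.*2.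
  rewrite -mul2n exprM -exprVn -[X in (2 ^+ 2)^-1 ^+ X]card_ord -prodr_const -big_split /=.
  by apply: eq_bigr => k _; rewrite /e expr_div_n mulrAC.
rewrite ler_pdivrMr ?exprn_gt0 //; apply: le_trans main _.
by rewrite mulrDl mulrC lerD2l ler_peMr // invr_ge0 ltW.
Qed.

(** * Zeros along an orbit *)

Lemma infinite_set_unbounded (R : realType) (A : set R) :
  (forall B, exists2 z, A z & B <= `|z|) -> infinite_set A.
Proof.
move=> unb /finite_fsetP[X AX].
have [z] := unb (\sum_(x <- finmap.enum_fset X) `|x| + 1).
rewrite AX /= => zX; apply/negP; rewrite -ltNge.
by rewrite (big_rem z zX) /= -addrA ltrDl ltr_wpDl // sumr_ge0.
Qed.

Section Orbit.
Variables (R : realType) (q : R).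
Hypotheses (q_lt0 : q < 0) (q_lt1 : `|q| < 1).

(** [theta q (x / q) = 1 + x * theta q x], and [2 < |x * theta q x|]. *)
Lemma theta_orbit_step (x : R) : 2 <= `|x| -> 1 < `|theta q x| ->
  1 < `|theta q (x / q)| /\ 0 < x * theta q x * theta q (x / q).
Proof.
move=> x2 t1; have q0 : q != 0 by rewrite lt_eqF.
rewrite (theta_functional (x / q) q_lt1) mulrCA divff // mulr1.
set y := x * theta q x.
have y2 : 2 < `|y|.
  by rewrite normrM (le_lt_trans x2) ?ltr_pMr // (lt_le_trans _ x2).
split; first by have := lerB_normD y 1; rewrite normr1 [1 + y]addrC; lra.
have [y0|y0] := leP 0 y; first by rewrite (ger0_norm y0) in y2; nra.
by rewrite (ltr0_norm y0) in y2; nra.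
Qed.

(** Multiplying the sign conditions of two consecutive steps, the points
    contribute [x * (x / q)], which is negative. *)
Lemma theta_orbit_sign (x : R) : 2 <= `|x| -> 1 < `|theta q x| ->
  1 < `|theta q (x / q ^+ 2)| /\ theta q x * theta q (x / q ^+ 2) < 0.
Proof.
move=> x2 t1; have [t1' s1] := theta_orbit_step x2 t1.
have q0 : q != 0 by rewrite lt_eqF.
have xq2 : 2 <= `|x / q|.
  rewrite normrM normfV (le_trans x2) // ler_peMr // invf_ge1 ?normr_gt0 //.
  exact: ltW.
have [t2 s2] := theta_orbit_step xq2 t1'.
have -> : x / q ^+ 2 = x / q / q by rewrite expr2 invfM mulrA.
split=> //; have := mulr_gt0 s1 s2.
have -> : x * theta q x * theta q (x / q) * (x / q * theta q (x / q) * theta q (x / q / q))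
  = (x * theta q (x / q)) ^+ 2 * (theta q x * theta q (x / q / q)) / q by ring.
rewrite nmulr_lgt0 ?invr_lt0 // pmulr_rlt0 // lt0r sqr_ge0 andbT sqrf_eq0.
by apply: contraTneq s1 => h; rewrite mulrAC h mul0r ltxx.
Qed.

Lemma sign_change_root (f : R -> R) (a b : R) : continuous f -> a <= b ->
  f a * f b < 0 -> exists2 z, a <= z <= b & f z = 0.
Proof.
move=> fc ab fab.
have [||z] := @IVT R f a b 0 ab; first exact: continuous_subspaceT.
  rewrite ge_min le_max; move: fab.
  by have [fa|fa] := leP (f a) 0; have [fb|fb] := leP (f b) 0; nra.
by rewrite in_itv /=; exists z.
Qed.

Lemma theta_zero_beyond (x B : R) : 2 <= `|x| -> 1 < `|theta q x| ->
  exists z, [/\ 0 < x * z, B <= `|z| & theta q z = 0].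
Proof.
move=> x2 t1; have q0 : q != 0 by rewrite lt_eqF.
have Q0 : 0 < q ^+ 2 by rewrite lt0r sqr_ge0 expf_neq0.
have Q1 : q ^+ 2 <= 1 by rewrite -real_normK ?num_real // expr_le1 // ltW.
have VQ1 : 1 <= (q ^+ 2)^-1 by rewrite invf_ge1.
have orbit n : 2 <= `|x / q ^+ 2 ^+ n| /\ 1 < `|theta q (x / q ^+ 2 ^+ n)|.
  elim: n => [|n [IH2 IHt]]; first by rewrite divr1.
  rewrite exprSr invfM mulrA; split; last exact: (theta_orbit_sign IH2 IHt).1.
  by rewrite normrM (le_trans IH2) // ler_peMr // ger0_norm // ltW // invr_gt0.
have [n nB] : exists n, B <= `|x / q ^+ 2 ^+ n|.
  have /cvgrPdist_lt /(_ (`|B| + 1)^-1) : q ^+ 2 ^+ n @[n --> \oo] --> 0.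
    by apply: cvg_expr; rewrite normrX expr_lt1.
  rewrite invr_gt0 ltr_wpDl // => /(_ isT) [n _ /(_ n (leqnn n))] /=.
  rewrite sub0r normrN => nB; exists n; rewrite normrM normfV.
  have Qn : 0 < `|q ^+ 2 ^+ n| by rewrite normr_gt0 !expf_neq0.
  have BV : `|B| + 1 <= `|q ^+ 2 ^+ n|^-1.
    by rewrite -[leLHS]invrK lef_pV2 ?posrE ?invr_gt0 ?ltr_wpDl // ltW.
  have := ler_norm B; have := normr_ge0 B; nra.
have [y2 t1'] := orbit n; set y := x / _ in y2 t1' nB *.
have xy : 0 < x * y.
  rewrite /y mulrA -expr2 divr_gt0 ?(exprn_gt0 _ Q0) // lt0r sqr_ge0 andbT sqrf_eq0.
  by rewrite -normr_gt0 (lt_le_trans _ x2).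
have [_ sgn] := theta_orbit_sign y2 t1'.
have tc := theta_continuous q_lt1.
have [y0|y0] := leP 0 y.
  have yy : y <= y / q ^+ 2 by rewrite ler_peMr.
  have [z /andP[yz _] z0] := sign_change_root tc yy sgn.
  exists z; split=> //; last by rewrite (le_trans nB) // !ger0_norm // (le_trans y0).
  have y0' : 0 < y by rewrite lt0r y0 andbT; apply: contraTneq xy => ->; rewrite mulr0 ltxx.
  have x0 : 0 < x by rewrite -(pmulr_lgt0 _ y0').
  by rewrite mulr_gt0 // (lt_le_trans y0').
have yy : y / q ^+ 2 <= y by rewrite ler_neMr // ltW.
rewrite mulrC in sgn; have [z /andP[_ zy] z0] := sign_change_root tc yy sgn.
have zl0 : z < 0 by rewrite (le_lt_trans zy).
exists z; split=> //; last first.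
  by rewrite (le_trans nB) // !ltr0_norm // lerN2.
by rewrite nmulr_lgt0 // -(nmulr_lgt0 _ y0).
Qed.

End Orbit.

(** An orbit started at a positive [x] supplies the positive zeros; the same orbit
    entered one step later, at [x / q], supplies the negative ones. *)
Theorem theorem3 (R : realType) (q : R) (hq : -1 < q < 0) :
  infinite_set [set x : R | x < 0 /\ theta (q%:C : R[i]) (x%:C : R[i]) = 0] /\
  infinite_set [set x : R | 0 < x /\ theta (q%:C : R[i]) (x%:C : R[i]) = 0].
Proof.
have [q1 q0] := andP hq.
have q_lt1 : `|q| < 1 by rewrite ltr0_norm // ltrNl.
have q_gt0 : 0 < `|q| by rewrite normr_gt0 lt_eqF.
have [x x2 t1] := @theta_unbounded R q 2 1 ltac:(by rewrite q_gt0).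
have x0 : 0 < x by rewrite (lt_le_trans _ x2).
have x2' : 2 <= `|x| by rewrite ger0_norm // ltW.
split; apply: infinite_set_unbounded => B.
  have [t1' _] := theta_orbit_step q0 q_lt1 x2' t1.
  have xq2 : 2 <= `|x / q|.
    by rewrite normrM normfV (le_trans x2') // ler_peMr // invf_ge1 // ltW.
  have [z [xz Bz z0]] := theta_zero_beyond q0 q_lt1 B xq2 t1'.
  exists z => //=; split; last by rewrite theta_real_complex // z0.
  by rewrite -(nmulr_rgt0 _ (_ : x / q < 0)) // pmulr_rlt0 // invr_lt0.
have [z [xz Bz z0]] := theta_zero_beyond q0 q_lt1 B x2' t1.
exists z => //=; split; last by rewrite theta_real_complex // z0.
by rewrite -(pmulr_rgt0 _ x0).
Qed.
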